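(* Let $d,t\geq 2$ be integers and let $\mathcal{F}= \{(A^1_i, A^2_i,\ldots, A^d_i) : 1\leq i\leq t \}$ be a family of $t$ $d$-tuples of finite sets such that, for all $i,i'\in\{1,\dots,t\}$ and $j,j'\in\{1,\dots,d\}$, $A^j_i \cap A^{j'}_{i'}=\emptyset$ if and only if $i= i'$ and $j\neq j'$. Then $$\frac{d}{2}\, t\log_2 t \le \sum_{i=1}^{t}\sum_{j=1}^{d} |A^j_i|.$$
   Context: The superscript $j$ in $A_i^j$ is an index (position in the $d$-tuple), not a power. The property with $i=i'$, $j=j'$ says in particular that every $A_i^j$ is nonempty. *)

(* Defs.v *)
From mathcomp Require Import all_boot all_order all_algebra.
From mathcomp Require Import finmap.
From mathcomp Require Import reals exp.

Set Implicit Arguments.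
Unset Strict Implicit.
Unset Printing Implicit Defensive.

Import Order.TTheory GRing.Theory Num.Theory.
Local Open Scope ring_scope.

Definition log2 (R : realType) (x : R) : R := ln x / ln 2.

(* [A i j] is the j-th entry of the i-th tuple; indices start at 0. *)
Definition cross_intersecting_tuples (K : choiceType) (d t : nat)
    (A : 'I_t -> 'I_d -> {fset K}) : Prop :=
  forall (i i' : 'I_t) (j j' : 'I_d),
    (A i j `&` A i' j')%fset = fset0 <-> (i = i' /\ j <> j').

(* Main.v *)
Require Import Defs.
From mathcomp Require Import all_boot all_order all_algebra.
From mathcomp Require Import finmap.
From mathcomp Require Import reals exp.
From mathcomp Require Import lra.

(** Fix two positions [j != j'] and write [a i] and [b i] for the [j]-th and
    [j']-th sets of tuple [i].  A uniformly random subset [X] of the ground set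
    contains [a i] and avoids [b i] with probability [2^-(|a i| + |b i|)], and
    these events are pairwise disjoint because [a i] meets [b i'] when
    [i != i'] (Hansel's argument).  Hence [sum_i 2^-(|a i| + |b i|) <= 1], and
    concavity of the logarithm gives [t log2 t <= sum_i (|a i| + |b i|)].
    Summing over the [d] cyclically consecutive pairs of positions counts every
    set twice. *)

Import Order.TTheory GRing.Theory Num.Theory.
Local Open Scope ring_scope.

(** Adjoining [A] to each of the [2 ^ (#|T| - #|A| - #|B|)] subsets of the complement of [A :|: B]
    gives distinct members of the interval, since removing [A] undoes it. *)
Lemma exp2_card_le_interval (T : finType) (A B : {set T}) :
  [disjoint A & B] ->
  (2 ^ #|T| <= #|[set X : {set T} | (A \subset X) && [disjoint X & B]]|
               * 2 ^ (#|A| + #|B|))%N.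
Proof.
move=> dAB.
have cAB : (#|A| + #|B| = #|A :|: B|)%N.
  by apply/esym/eqP; rewrite (leq_card_setU A B).
rewrite -(cardsC (A :|: B)) addnC expnD cAB leq_mul2r; apply/orP; right.
rewrite -card_powerset -(@card_in_imset _ _ (fun X => X :|: A)).
  apply/subset_leq_card/subsetP => Y /imsetP[X].
  rewrite powersetE setCU subsetI => /andP[_ XB] ->{Y}.
  by rewrite inE subsetUr disjoints_subset subUset XB -disjoints_subset.
have XA (X : {set T}) : X \in powerset (~: (A :|: B)) -> (X :|: A) :\: A = X.
  rewrite powersetE setCU subsetI -disjoints_subset => /andP[dXA _].
  by rewrite setDUl setDv setU0; apply/setDidPl.
by move=> X Y /XA {2}<- /XA {2}<- ->.
Qed.

Lemma sum_inv_exp2_card_le1 (F : numFieldType) (I T : finType)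
    (A B : I -> {set T}) :
  (forall i, [disjoint A i & B i]) ->
  (forall i i', i != i' -> ~~ [disjoint A i & B i']) ->
  \sum_i (2 ^+ (#|A i| + #|B i|))^-1 <= 1 :> F.
Proof.
move=> dAB xAB.
pose S i := [set X : {set T} | (A i \subset X) && [disjoint X & B i]].
have S_sum : (\sum_i #|S i| <= 2 ^ #|T|)%N.
  (* Double counting: it suffices that each [X] lies in at most one [S i]. If it lay in [S i] and
     [S i'], then [A i'] inside [X] would miss [B i]. *)
  under eq_bigr => i _ do rewrite -sum1_card big_mkcond.
  rewrite exchange_big -cardsT -card_powerset powersetT cardsT -sum1_card.
  apply: leq_sum => X _; rewrite -big_mkcond sum1_card /=.
  apply/card_le1_eqP => i i' Xi Xi'; apply/eqP/negPn/negP => /xAB/negP; apply.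
  have [/setIdP[_ XB] /setIdP[AX _]] : X \in S i /\ X \in S i' by [].
  exact: disjointWl AX XB.
have pow_gt0 n : 0 < 2 ^+ n :> F by rewrite exprn_gt0.
rewrite -(ler_pM2l (pow_gt0 #|T|)) mulr1 mulr_sumr.
apply: (@le_trans _ _ (\sum_i #|S i|%:R)); last first.
  by rewrite -natr_sum -natrX ler_nat.
apply: ler_sum => i _; rewrite ler_pdivrMr // -!natrX -natrM ler_nat.
exact: exp2_card_le_interval.
Qed.

Lemma mul_log2_le_sum (R : realType) (t : nat) (s : 'I_t -> nat) :
  (0 < t)%N -> \sum_i (2 ^+ s i)^-1 <= 1 :> R ->
  t%:R * log2 (t%:R : R) <= (\sum_i s i)%:R.
Proof.
move=> t_gt0 hs; rewrite /log2 mulrA.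
have ln2_gt0 : 0 < ln (2 : R) by rewrite ln_gt0 // ltr1n.
have tR_gt0 : 0 < t%:R :> R by rewrite ltr0n.
rewrite ler_pdivrMr // natr_sum mulr_suml.
(* Jensen's inequality in the form [ln x <= x - 1] at [x = t / 2 ^+ s i]. *)
have ln_le i : ln (t%:R : R) - (s i)%:R * ln 2 <= t%:R * (2 ^+ s i)^-1 - 1.
  have p_gt0 : 0 < 2 ^+ s i :> R by rewrite exprn_gt0.
  have := @le_ln1Dx R (t%:R * (2 ^+ s i)^-1 - 1).
  rewrite [1 + _]addrC subrK lnM ?posrE ?invr_gt0 // lnV ?posrE // lnXn //.
  rewrite [_ * ln 2]mulr_natl; apply; rewrite ltrBDr addNr.
  by rewrite mulr_gt0 ?invr_gt0.
(* The right-hand sides sum to [t] times the sum in [hs], minus [t], which is at most 0. *)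
have := ler_sum (index_enum 'I_t) (P := xpredT) (fun i _ => ln_le i).
rewrite !sumrB -mulr_sumr !sumr_const card_ord.
rewrite -[_ *+ t]mulr_natl => le1.
have le2 : t%:R * (\sum_i (2 ^+ s i)^-1) <= t%:R :> R.
  by rewrite -[leRHS]mulr1 ler_pM2l.
rewrite -subr_le0; apply: le_trans le1 _.
by rewrite subr_le0.
Qed.

Lemma mul_log2_le_sum_card_pairs (R : realType) (K : choiceType) (t : nat)
    (A B : 'I_t -> {fset K}) :
  (0 < t)%N ->
  (forall i, (A i `&` B i = fset0)%fset) ->
  (forall i i', i != i' -> (A i `&` B i' <> fset0)%fset) ->
  t%:R * log2 (t%:R : R) <= (\sum_i (#|` A i| + #|` B i|))%:R.
Proof.
move=> t_gt0 dAB xAB.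
(* [K] may be infinite, so the finite union [C] serves as the ground set; [fsub C] preserves
   cardinality and disjointness. *)
pose C := (\bigcup_(i <- enum 'I_t) (A i `|` B i))%fset.
have UC i : (A i `|` B i `<=` C)%fset by apply: bigfcup_sup => //; rewrite mem_enum.
have AC i : (A i `<=` C)%fset := fsubset_trans (fsubsetUl _ _) (UC i).
have BC i : (B i `<=` C)%fset := fsubset_trans (fsubsetUr _ _) (UC i).
have dE i i' : [disjoint fsub C (A i) & fsub C (B i')]
    = ((A i `&` B i')%fset == fset0).
  by rewrite disjoint_fsub // fsubUset AC BC.
under eq_bigr => i _ do rewrite -(card_fsub (AC i)) -(card_fsub (BC i)).
apply: mul_log2_le_sum => //.
apply: sum_inv_exp2_card_le1 => [i|i i' /xAB].
  by rewrite dE dAB.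
by rewrite dE => /eqP.
Qed.

Lemma ordS_neq (n : nat) (i : 'I_n) : (1 < n)%N -> ordS i != i.
Proof.
move=> n_gt1; apply/negP => /eqP/(congr1 val) /=.
have [lt_in|] := ltnP i.+1 n.
  by rewrite modn_small // => /esym/n_Sn.
(* Wrap-around: the successor is 0, so a fixed point would force [n <= 1]. *)
move=> le_ni; have /eqP -> : i.+1 == n by rewrite eqn_leq ltn_ord le_ni.
by rewrite modnn => i0; move: le_ni; rewrite -i0 leqNgt n_gt1.
Qed.

Theorem theorem7 (R : realType) (K : choiceType) (d t : nat)
    (hd : (2 <= d)%N) (ht : (2 <= t)%N)
    (A : 'I_t -> 'I_d -> {fset K})
    (hA : cross_intersecting_tuples A) :
  d%:R / 2 * (t%:R * log2 (t%:R : R))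
    <= (\sum_(i < t) \sum_(j < d) #|` A i j|)%:R.
Proof.
pose c j := (\sum_(i < t) #|` A i j|)%N.
have c_pair j : t%:R * log2 (t%:R : R) <= (c j + c (ordS j))%:R.
  rewrite /c -big_split /=; apply: mul_log2_le_sum_card_pairs; first exact: ltnW.
    by move=> i; apply/hA; split=> //; apply/eqP; rewrite eq_sym ordS_neq.
  by move=> i i' /eqP ne_ii' /hA[].
have := ler_sum (index_enum 'I_d) (P := xpredT) (fun j _ => c_pair j).
rewrite sumr_const card_ord -natr_sum big_split /=.
(* [ordS] permutes the positions, so both sums equal the total size. *)
rewrite -(reindex_inj (@ordS_inj d) (P := xpredT) (F := c)) /= natrD.
rewrite exchange_big /= -/c -[_ *+ d]mulr_natl => le2.
by lra.
Qed.
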